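(* For any positive integers $k,p,r$: \[ \xi(\{1\}_{r-1},k;p)=\sum_{j=1}^r\sum_{\substack{k_1+\cdots+k_j=k+j-1\\ k_1,\ldots,k_j\ge1}}(-1)^{j-1}\binom{p+r-j-1}{p-1}\xi(k_1,\ldots,k_j;p+r-j), \] \[ \sum_{\substack{k_1+\cdots+k_r=k+r-1\\ k_1,\ldots,k_r\ge1}}\xi(k_1,\ldots,k_r;p)=\sum_{j=1}^r(-1)^{j-1}\binom{p+r-j-1}{p-1}\xi(\{1\}_{j-1},k;p+r-j), \] \[ \psi(\{1\}_{r-1},k;p)=\sum_{j=1}^r\sum_{\substack{k_1+\cdots+k_j=k+j-1\\ k_1,\ldots,k_j\ge1}}(-1)^{j-1}\binom{p+r-j-1}{p-1}\psi(k_1,\ldots,k_j;p+r-j), \] \[ \sum_{\substack{k_1+\cdots+k_r=k+r-1\\ k_1,\ldots,k_r\ge1}}\psi(k_1,\ldots,k_r;p)=\sum_{j=1}^r(-1)^{j-1}\binom{p+r-j-1}{p-1}\psi(\{1\}_{j-1},k;p+r-j). \]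
   Context: ${\rm Li}_{k_1,\ldots,k_r}(z)=\sum_{1\le n_1<\cdots<n_r}\frac{z^{n_r}}{n_1^{k_1}\cdots n_r^{k_r}}$ and ${\rm A}(k_1,\ldots,k_r;z)=2^r\sum_{1\le n_1<\cdots<n_r,\ n_i\equiv i \pmod 2}\frac{z^{n_r}}{n_1^{k_1}\cdots n_r^{k_r}}$ for $z\in[-1,1)$. $\xi(k_1,\ldots,k_r;s)=\frac{1}{\Gamma(s)}\int_0^\infty\frac{t^{s-1}}{e^t-1}{\rm Li}_{k_1,\ldots,k_r}(1-e^{-t})\,dt$ and $\psi(k_1,\ldots,k_r;s)=\frac{1}{\Gamma(s)}\int_0^\infty t^{s-1}\frac{{\rm A}(k_1,\ldots,k_r;\tanh(t/2))}{\sinh t}\,dt$. $\{1\}_j$ denotes $j$ repetitions of $1$. *)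

(* Defs.v *)
From mathcomp Require Import all_boot all_order all_algebra.
From mathcomp Require Import all_classical all_reals all_analysis.
Set Implicit Arguments.
Unset Strict Implicit.
Unset Printing Implicit Defensive.
Import Order.TTheory GRing.Theory Num.Theory.
Import numFieldNormedType.Exports.

Local Open Scope classical_set_scope.
Local Open Scope ring_scope.

(* [path ltn 0 n] says 1 <= n_1 < ... < n_r. The multiple series are summed
   along the outermost index: they are limits of the partial sums n_r <= N,
   which also covers z = -1, where convergence need not be absolute. *)
Definition polylog (R : realType) (ks : seq nat) (z : R) : R :=
  limn (fun N : nat =>
    \sum_(n : (size ks).-tuple 'I_N.+1 | path ltn 0%N (map val n))
      z ^+ last 0%N (map val n)
      / \prod_(i < size ks) (tnth n i)%:R ^+ nth 0%N ks i).

(* The position i counts from 0 here, so the parity condition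
   n_i = i (mod 2) of the 1-based convention is stated with i.+1. *)
Definition Apolylog (R : realType) (ks : seq nat) (z : R) : R :=
  2 ^+ size ks *
  limn (fun N : nat =>
    \sum_(n : (size ks).-tuple 'I_N.+1 |
        path ltn 0%N (map val n)
        && [forall i : 'I_(size ks), tnth n i == i.+1 %[mod 2]])
      z ^+ last 0%N (map val n)
      / \prod_(i < size ks) (tnth n i)%:R ^+ nth 0%N ks i).

Definition sinh (R : realType) (t : R) : R := (expR t - expR (- t)) / 2.
Definition cosh (R : realType) (t : R) : R := (expR t + expR (- t)) / 2.
Definition tanh (R : realType) (t : R) : R := sinh t / cosh t.

Definition Gamma (R : realType) (s : R) : R :=
  \int[lebesgue_measure]_(t in `]0, +oo[) (t `^ (s - 1) * expR (- t)).

Definition xi (R : realType) (ks : seq nat) (s : R) : R :=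
  (Gamma s)^-1 *
  \int[lebesgue_measure]_(t in `]0, +oo[)
    (t `^ (s - 1) / (expR t - 1) * polylog ks (1 - expR (- t))).

Definition psi (R : realType) (ks : seq nat) (s : R) : R :=
  (Gamma s)^-1 *
  \int[lebesgue_measure]_(t in `]0, +oo[)
    (t `^ (s - 1) * (Apolylog ks (tanh (t / 2)) / sinh t)).

Definition is_composition (w : nat) (ks : seq nat) : bool :=
  all (leq 1) ks && (sumn ks == w).

(* Sum of [F [:: k_1; ...; k_j]] over the k_1, ..., k_j >= 1 with
   k_1 + ... + k_j = w; each entry is at most w, so ['I_w.+1] loses nothing. *)
Definition sum_compositions (R : realType) (j w : nat) (F : seq nat -> R) : R :=
  \sum_(ks : j.-tuple 'I_w.+1 | is_composition w (map val ks)) F (map val ks).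

(* Main.v *)
Require Import Defs.
From mathcomp Require Import all_boot all_order all_algebra.
From mathcomp Require Import all_classical all_reals all_analysis.
From mathcomp Require Import measurable_realfun ring lra zify.
Import Order.TTheory GRing.Theory Num.Theory.
Import numFieldNormedType.Exports.
Local Open Scope ring_scope.
Set Implicit Arguments.
Unset Strict Implicit.

(* Put z(t) = 1 - exp(-t) for xi and z(t) = tanh(t/2) for psi. In both cases the
   kernel of the integral is z'/z, and composing Li (resp. A) with z turns the
   operation of appending a last index 1 into plain integration in t, and that
   of increasing the last index by 1 into integration against z'/z. In
   particular the index {1}_r gives t^r/r!.

   Write P_(r,m)(t) for the function of index ({1}_(r-1), m+1) and S_(j,m)(t)
   for the sum of the functions over all compositions of m+j into j parts. Then
     P_(r,m) = sum_(j=1)^r (-1)^(j-1) t^(r-j)/(r-j)! S_(j,m),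
     S_(r,m) = sum_(j=1)^r (-1)^(j-1) t^(r-j)/(r-j)! P_(j,m)
   because both sides vanish at 0 and obey the same differential equations: for
   m >= 1, P_(r,m)' = (z'/z) P_(r,m-1) and
   S_(j,m)' = S_(j-1,m) + (z'/z) S_(j,m-1), and the terms created by
   differentiating t^(r-j)/(r-j)! telescope. Multiplying by t^(p-1) z'/z and
   integrating gives the theorem, the factor 1/(r-j)! becoming a binomial
   coefficient after division by Gamma(p) and Gamma(p+r-j). *)

(** * Compositions *)

Definition incr_head (c : seq nat) : seq nat := (head 0%N c).+1 :: behead c.

(* The compositions of [m + j] into [j] parts, last part first; they are sorted
   by whether that part is 1, since the two cases differentiate differently. *)
Fixpoint rcompositions (j : nat) : nat -> seq (seq nat) :=
  match j with
  | 0 => fun m => if m is 0 then [:: [::]] else [::]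
  | j'.+1 => fix aux m :=
      [seq 1%N :: c | c <- rcompositions j' m] ++
      (if m is m'.+1 then [seq incr_head c | c <- aux m'] else [::])
  end.

Lemma rcompositionsS0 (j : nat) :
  rcompositions j.+1 0 = [seq 1%N :: c | c <- rcompositions j 0].
Proof. by rewrite /= cats0. Qed.

Lemma rcompositionsSS (j m : nat) : rcompositions j.+1 m.+1 =
  [seq 1%N :: c | c <- rcompositions j m.+1] ++
  [seq incr_head c | c <- rcompositions j.+1 m].
Proof. by []. Qed.

(** The empty list must be excluded, as it has the same image as [[:: 0]]. *)
Lemma incr_head_inj : {in [pred c | c != [::]] &, injective incr_head}.
Proof. by case=> [|a c] [|b d] //= _ _ [-> ->]. Qed.

(** Double induction along the recursion: a composition either starts with 1, and removing that
    entry lowers [j], or starts with at least 2, and decreasing that entry lowers [m]. *)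
Lemma mem_rcompositions (j m : nat) (c : seq nat) :
  (c \in rcompositions j m) =
  [&& size c == j, all (leq 1) c & sumn c == (m + j)%N].
Proof.
elim: j m c => [|j IHj] m c.
  by case: m => [|m]; case: c => [|a c] //=; rewrite inE.
elim: m c => [|m IHm] c.
  rewrite rcompositionsS0; apply/mapP/and3P => [[d]|[]].
    by rewrite IHj => /and3P[/eqP ds dp /eqP dw] ->; rewrite /= ds dw dp; split.
  case: c => [|a c] //= /eqP[cs] /andP[a0 cp] /eqP cw.
  (* For [m = 0] the sum equals the number of parts, all at least 1, so the head must be 1. *)
  have cj : (size c <= sumn c)%N.
    by elim: c cp {cs cw} => //= b c IHc /andP[b0 /IHc]; lia.
  have a1 : a = 1%N by lia.
  by exists c; rewrite ?a1// IHj cs eqxx cp; apply/eqP; lia.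
rewrite rcompositionsSS mem_cat; apply/orP/and3P => [[]/mapP[d]|].
- rewrite IHj => /and3P[/eqP ds dp /eqP dw] ->; rewrite /= ds dp; split => //.
  by apply/eqP; lia.
- rewrite IHm => /and3P[/eqP + dp /eqP dw] ->.
  case: d dp dw => [//|a d] /= /andP[_ ->] dw [->]; split => //.
  by apply/eqP; lia.
- case; case: c => [|[|[|a]] c] //= /eqP[cs] cp /eqP cw.
    by left; apply/mapP; exists c => //; rewrite IHj cs eqxx cp; apply/eqP; lia.
  right; apply/mapP; exists (a.+1 :: c) => //.
  by rewrite IHm /= cs eqxx cp; apply/eqP; lia.
Qed.

Lemma rcompositions_uniq (j m : nat) : uniq (rcompositions j m).
Proof.
elim: j m => [|j IHj] m; first by case: m.
elim: m => [|m IHm]; first by rewrite rcompositionsS0 map_inj_uniq// => c d [].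
rewrite rcompositionsSS cat_uniq map_inj_uniq ?IHj ?andTb;
  last by move=> c d [].
(* The two sublists are disjoint: the head is 1 in the first and at least 2 in the second. *)
apply/andP; split.
  apply/hasPn => _ /mapP[c + ->]; rewrite mem_rcompositions.
  by case/and3P; case: c => [|[|a] c] //= _ _ _; apply/mapP => -[d _ []].
rewrite map_inj_in_uniq// => c d.
by rewrite !mem_rcompositions => /and3P[cs _ _] /and3P[ds _ _];
   apply: incr_head_inj; [case: c cs|case: d ds].
Qed.

(** Both enumerations are free of duplicates, so comparing members suffices; [rev] restores the
    order of the indices. *)
Lemma sum_compositionsE {R : realType} (j m : nat) (F : seq nat -> R) :
  sum_compositions j (m + j) F = \sum_(c <- rcompositions j m) F (rev c).
Proof.
rewrite /sum_compositions -big_filter.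
set w := (m + j)%N.
rewrite -(big_map (fun ks : j.-tuple 'I_w.+1 => map val ks) xpredT F).
rewrite -(big_map rev xpredT F); apply/perm_big/uniq_perm.
- rewrite map_inj_in_uniq ?filter_uniq ?index_enum_uniq// => s t _ _ st.
  exact/val_inj/(inj_map val_inj).
- by rewrite map_inj_uniq ?rcompositions_uniq//; exact: (can_inj revK).
move=> s; apply/mapP/mapP => [[ks]|[c]].
  rewrite mem_filter => /andP[/andP[sp /eqP sw] _] ->.
  exists (rev (map val ks)); last by rewrite revK.
  rewrite mem_rcompositions size_rev size_map size_tuple eqxx all_rev sp.
  by rewrite sumn_rev sw eqxx.
rewrite mem_rcompositions => /and3P[/eqP cs cp /eqP cw] ->.
(* [inord] changes no entry, since each part is at most the total [w]. *)
have sz : size (rev (map (@inord w) c)) == j by rewrite size_rev size_map cs.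
have E : map val (Tuple sz) = rev c.
  rewrite /= map_rev -map_comp; congr rev; rewrite -[RHS]map_id.
  apply/eq_in_map => a ac /=; rewrite inordK// ltnS /w -cw.
  elim: c ac {cp cw cs sz} => //= b c IH.
  by rewrite inE => /orP[/eqP->|/IH]; lia.
exists (Tuple sz) => //; rewrite mem_filter mem_index_enum andbT.
by rewrite /is_composition E all_rev cp sumn_rev cw /=.
Qed.

(** * The differential equations *)

Section Derivatives.
Context {R : realType}.
Implicit Types (f g df dg : R -> R) (t : R).

(* The formula for the derivative is required only on t > 0, since the
   derivatives met below have a factor that is singular at 0. *)
Definition has_deriv f df : Prop :=
  (forall t, 0 <= t -> derivable f t 1) /\
  (forall t, 0 < t -> is_derive t 1 f (df t)).

Lemma has_deriv_ext f df df' :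
  (forall t, 0 < t -> df t = df' t) -> has_deriv f df -> has_deriv f df'.
Proof.
by move=> e [f1 f2]; split=> // t t0; rewrite -e//; exact: f2.
Qed.

Lemma has_deriv_continuous f df t : has_deriv f df -> 0 <= t ->
  {for t, continuous f}.
Proof.
by move=> [f1 _] t0; apply/differentiable_continuous/derivable1_diffP/f1.
Qed.

Lemma has_deriv_cst (a : R) : has_deriv (fun=> a) (fun=> 0).
Proof. by split=> t _; [exact: derivable_cst|exact: is_derive_cst]. Qed.

Lemma has_derivD f g df dg : has_deriv f df -> has_deriv g dg ->
  has_deriv (fun t => f t + g t) (fun t => df t + dg t).
Proof.
move=> [f1 f2] [g1 g2]; split=> t t0.
  by apply: derivableD; [exact: f1|exact: g1].
by apply: is_deriveD; [exact: f2|exact: g2].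
Qed.

Lemma has_derivM f g df dg : has_deriv f df -> has_deriv g dg ->
  has_deriv (fun t => f t * g t) (fun t => df t * g t + f t * dg t).
Proof.
move=> [f1 f2] [g1 g2]; split=> t t0.
  by apply: derivableM; [exact: f1|exact: g1].
have H := is_deriveM (f2 _ t0) (g2 _ t0).
by apply: is_derive_eq H _; rewrite addrC [df t * _]mulrC.
Qed.

Lemma has_deriv_sum (I : eqType) (s : seq I) (F dF : I -> R -> R) :
  {in s, forall i, has_deriv (F i) (dF i)} ->
  has_deriv (fun t => \sum_(i <- s) F i t) (fun t => \sum_(i <- s) dF i t).
Proof.
elim: s => [_|i s IHs Fs].
  under [X in has_deriv X]eq_fun do rewrite big_nil.
  under [X in has_deriv _ X]eq_fun do rewrite big_nil.
  exact: has_deriv_cst.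
under [X in has_deriv X]eq_fun do rewrite big_cons.
under [X in has_deriv _ X]eq_fun do rewrite big_cons.
apply: has_derivD; first by apply: Fs; rewrite inE eqxx.
by apply: IHs => j js; apply: Fs; rewrite inE js orbT.
Qed.

(** Mean value theorem for [f - g] on [0, t]: continuity is used on the closed interval, the
    derivative only in its interior. *)
Lemma has_deriv_inj f g df t : has_deriv f df -> has_deriv g df ->
  f 0 = g 0 -> 0 <= t -> f t = g t.
Proof.
move=> [f1 f2] [g1 g2] fg0; rewrite le_eqVlt => /predU1P[<-//|t0].
have cfg : {within `[0, t], continuous (f - g)}%classic.
  apply: derivable_within_continuous => x; rewrite in_itv/= => /andP[x0 _].
  by apply: derivableB; [exact: f1|exact: g1].
have dfg x : x \in `]0, t[ -> is_derive x 1 (f - g) ((fun=> 0) x).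
  rewrite in_itv/= => /andP[x0 _].
  have := f2 _ x0; have := g2 _ x0 => dgx dfx.
  by apply: is_derive_eq; rewrite subrr.
have [c _ +] := MVT t0 dfg cfg.
rewrite mul0r => /eqP; rewrite subr_eq0 => /eqP.
change (f t - g t = f 0 - g 0 -> f t = g t); rewrite fg0 subrr => /eqP.
by rewrite subr_eq0 => /eqP.
Qed.

Definition divpow (n : nat) (t : R) : R := t ^+ n / n`!%:R.

Lemma divpow0 t : divpow 0 t = 1.
Proof. by rewrite /divpow expr0 divr1. Qed.

Lemma divpowS0 n : divpow n.+1 0 = 0.
Proof. by rewrite /divpow expr0n mul0r. Qed.

Lemma divpow_ge0 n t : 0 <= t -> 0 <= divpow n t.
Proof. by move=> t0; rewrite divr_ge0 ?exprn_ge0. Qed.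

Lemma has_deriv_divpow n : has_deriv (divpow n.+1) (divpow n).
Proof.
have d t : is_derive t 1 (divpow n.+1) (divpow n t).
  have -> : divpow n.+1 = (n.+1`!%:R^-1 : R) \*: (id ^+ n.+1 : R -> R).
    by apply/funext => x; rewrite /divpow mulrC /GRing.scale/= fctE.
  have H := is_deriveZ (n.+1`!%:R^-1 : R) (is_deriveX n.+1 (is_derive_id t 1)).
  apply: is_derive_eq H _.
  rewrite /divpow factS natrM /GRing.scale/= mulr1.
  by field; rewrite nat1r pnatr_eq0 -lt0n fact_gt0 pnatr_eq0.
by split=> t _; [exact: ex_derive|exact: d].
Qed.

Lemma has_deriv_divpow_pred n :
  has_deriv (divpow n) (fun t => if n is n'.+1 then divpow n' t else 0).
Proof.
case: n => [|n]; last exact: has_deriv_divpow.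
have -> : divpow 0 = fun=> 1 by apply/funext => t; rewrite divpow0.
exact: has_deriv_cst.
Qed.

(* [r.-1 - j] because [j] runs from 0: the term of depth [j.+1] out of [r]. *)
Definition altconv (r : nat) (F : nat -> R -> R) (t : R) : R :=
  \sum_(j < r) (-1) ^+ j * divpow (r.-1 - j) t * F j t.

(** Removing the term [j = 0] leaves the shifted family with the opposite sign; the later
    cancellations rest on this. *)
Lemma altconvS (r : nat) (F : nat -> R -> R) t :
  altconv r.+1 F t = divpow r t * F 0%N t - altconv r (fun j => F j.+1) t.
Proof.
rewrite /altconv big_ord_recl /= expr0 mul1r subn0; congr (_ + _).
rewrite -sumrN; apply: eq_bigr => j _.
by rewrite exprS (_ : r.-1 - j = r - bump 0 j)%N; [ring|rewrite /bump/=; lia].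
Qed.

Lemma altconvD (r : nat) (F G : nat -> R -> R) t :
  altconv r (fun j t => F j t + G j t) t = altconv r F t + altconv r G t.
Proof.
by rewrite /altconv -big_split; apply: eq_bigr => j _; rewrite mulrDr.
Qed.

Lemma altconvZ (r : nat) (a : R -> R) (F : nat -> R -> R) t :
  altconv r (fun j t => a t * F j t) t = a t * altconv r F t.
Proof.
by rewrite /altconv mulr_sumr; apply: eq_bigr => j _; rewrite mulrCA.
Qed.

Lemma altconv_at0 (r : nat) (F : nat -> R -> R) :
  (forall j, F j 0 = 0) -> altconv r F 0 = 0.
Proof. by move=> F0; rewrite /altconv big1// => j _; rewrite F0 mulr0. Qed.

(** Product rule. Differentiating [divpow (r - j)] lowers its degree, which turns length [r.+1] into
    length [r]; for [j = r] this factor is constant and its derivative drops out. *)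
Lemma has_deriv_altconv (r : nat) (F dF : nat -> R -> R) :
  (forall j, has_deriv (F j) (dF j)) ->
  has_deriv (altconv r.+1 F) (fun t => altconv r F t + altconv r.+1 dF t).
Proof.
move=> FdF.
pose G (j : 'I_r.+1) t := ((-1) ^+ j * divpow (r - j) t) * F j t.
pose de k t : R := if k is k'.+1 then divpow k' t else 0.
pose dG (j : 'I_r.+1) t :=
  (0 * divpow (r - j) t + (-1) ^+ j * de (r - j)%N t) * F j t
    + ((-1) ^+ j * divpow (r - j) t) * dF j t.
apply: (@has_deriv_ext _ (fun t => \sum_(j < r.+1) dG j t)); last first.
  apply: has_deriv_sum => j _; apply: has_derivM => //.
  by apply: has_derivM; [exact: has_deriv_cst|exact: has_deriv_divpow_pred].
move=> t _; rewrite /dG big_split; congr (_ + _).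
rewrite big_ord_recr /= subnn mul0r mulr0 addr0 mul0r addr0.
apply: eq_bigr => j _; rewrite mul0r add0r.
by rewrite (_ : r - j = (r.-1 - j).+1)%N//; have := ltn_ord j; lia.
Qed.

End Derivatives.

(** * Duality between height-one functions and sums of fixed depth *)

Section Duality.
Context {R : realType} (Phi : seq nat -> R -> R) (h : R -> R).
Hypothesis Phi_nil : forall t, Phi [::] t = 1.
Hypothesis Phi_at0 : forall k c, Phi (k :: c) 0 = 0.
Hypothesis has_deriv_Phi1 : forall c, all (leq 1) c ->
  has_deriv (Phi (1%N :: c)) (Phi c).
Hypothesis has_deriv_PhiS : forall k c, all (leq 1) c ->
  has_deriv (Phi (k.+2 :: c)) (fun t => h t * Phi (k.+1 :: c) t).

Definition depth_sum (j m : nat) (t : R) : R :=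
  \sum_(c <- rcompositions j m) Phi c t.

(** This is P_(r+1,m): [r] counts the ones, and the head of the list is the last index. *)
Definition height_one (r m : nat) : R -> R := Phi (m.+1 :: nseq r 1%N).

Lemma all_leq1_nseq1 r : all (leq 1) (nseq r 1%N).
Proof. by elim: r. Qed.

Lemma Phi_nseq1 r t : 0 <= t -> Phi (nseq r 1%N) t = divpow r t.
Proof.
elim: r t => [|r IHr] t t0; first by rewrite Phi_nil divpow0.
apply: (@has_deriv_inj _ _ _ (divpow r)) t0.
- apply: has_deriv_ext _ (has_deriv_Phi1 (all_leq1_nseq1 r)) => u u0.
  exact/IHr/ltW.
- exact: has_deriv_divpow.
- by rewrite Phi_at0 divpowS0.
Qed.

Lemma depth_sum0 m t : depth_sum 0 m t = (m == 0%N)%:R.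
Proof. by case: m => [|m]; rewrite /depth_sum ?big_seq1 ?big_nil. Qed.

Lemma depth_sum_at0 j m : depth_sum j.+1 m 0 = 0.
Proof.
rewrite /depth_sum big_seq big1// => -[|k c]; last by rewrite Phi_at0.
by rewrite mem_rcompositions.
Qed.

Lemma depth_sum_0 r t : 0 <= t -> depth_sum r 0 t = divpow r t.
Proof.
move=> t0; rewrite -Phi_nseq1// /depth_sum.
suff -> : rcompositions r 0 = [:: nseq r 1%N] by rewrite big_seq1.
by elim: r => // r IHr; rewrite rcompositionsS0 IHr.
Qed.

Lemma has_deriv_depth_sum j m : has_deriv (depth_sum j.+1 m.+1)
  (fun t => depth_sum j m.+1 t + h t * depth_sum j.+1 m t).
Proof.
rewrite /depth_sum rcompositionsSS.
under [X in has_deriv X]eq_fun do rewrite big_cat !big_map.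
apply: has_derivD.
  apply: has_deriv_sum => c; rewrite mem_rcompositions => /and3P[_ c1 _].
  exact: has_deriv_Phi1.
under [X in has_deriv _ X]eq_fun do rewrite mulr_sumr.
apply: has_deriv_sum => c; rewrite mem_rcompositions => /and3P[].
by case: c => [|[|k] c] //= _ c1 _; exact: has_deriv_PhiS.
Qed.

Lemma has_deriv_depth_sum0 j :
  has_deriv (depth_sum j.+1 0) (depth_sum j 0).
Proof.
rewrite /depth_sum rcompositionsS0.
under [X in has_deriv X]eq_fun do rewrite big_map.
apply: has_deriv_sum => c; rewrite mem_rcompositions => /and3P[_ c1 _].
exact: has_deriv_Phi1.
Qed.

(** Induction on [m], comparing derivatives. On the right, the terms from differentiating the powers
    of t cancel the lower-depth terms from differentiating the depth sums, up to one boundary term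
    of depth 0. *)
Lemma height_one_altconv r m t : 0 <= t ->
  height_one r m t = altconv r.+1 (fun j => depth_sum j.+1 m) t.
Proof.
elim: m t => [|m IHm] t t0.
  apply: (@has_deriv_inj _ _ _ (divpow r)) t0.
  - apply: has_deriv_ext _ (has_deriv_Phi1 (all_leq1_nseq1 r)) => u u0.
    by rewrite Phi_nseq1// ltW.
  - have := has_deriv_altconv r (fun j => has_deriv_depth_sum0 j).
    apply: has_deriv_ext => u u0.
    (* The boundary term is [depth_sum 0 0 = 1] times [divpow r]. *)
    by rewrite altconvS depth_sum0 mulr1 addrC subrK.
  - by rewrite /height_one Phi_at0 altconv_at0// => j; rewrite depth_sum_at0.
apply: (@has_deriv_inj _ _ _ (fun u => h u * height_one r m u)) t0.
- exact: has_deriv_PhiS _ (all_leq1_nseq1 r).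
- have := has_deriv_altconv r (fun j => has_deriv_depth_sum j m).
  apply: has_deriv_ext => u u0.
  (* Now the boundary term is 0, and only [h] times the identity for [m] remains. *)
  rewrite altconvD altconvS depth_sum0 mulr0 add0r addNKr.
  by rewrite altconvZ -IHm// ltW.
- by rewrite /height_one Phi_at0 altconv_at0// => j; rewrite depth_sum_at0.
Qed.

(** Induction on [m], then on [r]. The derivative on the right splits into a sum of length [r],
    handled by the inner hypothesis, and [h] times the identity for the preceding [m]; nothing has
    to cancel. *)
Lemma depth_sum_altconv r m t : 0 <= t ->
  depth_sum r.+1 m t = altconv r.+1 (fun j => height_one j m) t.
Proof.
elim: m r t => [|m IHm] r.
  move=> t t0; apply: (@has_deriv_inj _ _ _ (divpow r)) t0.
  - apply: has_deriv_ext _ (has_deriv_depth_sum0 r) => u u0.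
    exact/depth_sum_0/ltW.
  - have := has_deriv_altconv r
      (fun j => has_deriv_Phi1 (all_leq1_nseq1 j)).
    apply: has_deriv_ext => u u0.
    by rewrite altconvS /= Phi_nil mulr1 addrC subrK.
  - by rewrite depth_sum_at0 altconv_at0// => j; rewrite /height_one Phi_at0.
elim: r => [|r IHr] t t0;
  apply: has_deriv_inj (has_deriv_depth_sum _ m) _ _ t0;
  try by rewrite depth_sum_at0 altconv_at0// => j; rewrite /height_one Phi_at0.
all: apply: has_deriv_ext _ (has_deriv_altconv _
  (fun j => has_deriv_PhiS m (all_leq1_nseq1 j))) => u u0.
all: rewrite altconvZ -/(height_one _ _) -IHm ?ltW//.
  by rewrite depth_sum0 /altconv big_ord0.
by rewrite -IHr// ltW.
Qed.

End Duality.

(** * Multiple polylogarithms as power series *)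

Section RadiusOne.
Context {R : realType}.
Local Open Scope classical_set_scope.
Implicit Types (c : nat -> R) (x q : R).

(** Unlike boundedness of the coefficients, this growth condition survives formal
    differentiation. *)
Definition radius_ge1 c : Prop :=
  forall K, 0 < K -> K < 1 -> exists M, forall i, `|c i| * K ^+ i <= M.

Lemma bounded_radius_ge1 c (M : R) : (forall i, `|c i| <= M) -> radius_ge1 c.
Proof.
move=> cM K K0 K1; exists M => i; apply: le_trans (cM i).
by rewrite ler_piMr// exprn_ile1// ltW.
Qed.

(** Each of the [i + 1] terms of 1 + q + ... + q^i is at least q^i, and that sum times 1 - q is 1 -
    q^(i+1). *)
Lemma succ_mul_expr_le q (i : nat) : 0 <= q -> q < 1 ->
  i.+1%:R * q ^+ i * (1 - q) <= 1 - q ^+ i.+1.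
Proof.
move=> q0 q1; elim: i => [|i IHi]; first by rewrite expr0 expr1 !mul1r.
have p0 : 0 <= q ^+ i.+1 by rewrite exprn_ge0.
have p1 : q ^+ i.+1 <= 1 by rewrite exprn_ile1// ltW.
rewrite -natr1 [q ^+ i.+2]exprS.
have -> : (i.+1%:R + 1) * q ^+ i.+1 * (1 - q) =
  q * (i.+1%:R * q ^+ i * (1 - q)) + q ^+ i.+1 * (1 - q).
  by rewrite exprS; ring.
have := ler_wpM2l q0 IHi; nra.
Qed.

Lemma radius_ge1_diffs c : radius_ge1 c -> radius_ge1 (pseries_diffs c).
Proof.
move=> rc K K0 K1.
(* With [K = q * L], the power [q ^+ i] absorbs the factor [i + 1] from differentiation, while [L]
   controls the coefficients. *)
have [L [L0 L1 KL]] : exists L, [/\ 0 < L, L < 1 & K < L].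
  by exists ((K + 1) / 2); split; lra.
have [M cM] := rc _ L0 L1; pose q := K / L.
have q0 : 0 <= q by rewrite divr_ge0// ltW.
have q1 : q < 1 by rewrite /q ltr_pdivrMr// mul1r.
have q1' : 0 < 1 - q by rewrite subr_gt0.
exists (M * (1 - q)^-1 / L) => i.
have E : `|pseries_diffs c i| * K ^+ i =
  `|c i.+1| * L ^+ i.+1 * (i.+1%:R * q ^+ i) / L.
  rewrite /pseries_diffs normrM normr_nat /q expr_div_n (exprS L).
  by field; rewrite expf_neq0 gt_eqF.
rewrite E ler_pM2r ?invr_gt0//; apply: ler_pM => //.
- by rewrite mulr_ge0// exprn_ge0// ltW.
- by rewrite mulr_ge0// exprn_ge0.
rewrite -[leRHS]mul1r ler_pdivlMr//.
apply: le_trans (succ_mul_expr_le i q0 q1) _.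
by rewrite gerBl exprn_ge0.
Qed.

Lemma radius_ge1_cvg c x : radius_ge1 c -> `|x| < 1 -> cvgn (pseries c x).
Proof.
move=> rc x1.
have [K [K0 K1 xK]] : exists K, [/\ 0 < K, K < 1 & `|x| < K].
  by exists ((`|x| + 1) / 2); have := normr_ge0 x; split; lra.
have [M cM] := rc _ K0 K1.
apply: normed_cvg; apply: (@series_le_cvg _ _ (geometric M (`|x| / K))).
- by move=> n; rewrite normr_ge0.
- move=> n; rewrite /geometric/= mulr_ge0 ?exprn_ge0 ?divr_ge0 ?(ltW K0)//.
  by apply: le_trans (cM 0%N); rewrite mulr_ge0 ?expr0.
- move=> n; rewrite /geometric/= normrM normrX expr_div_n mulrA.
  by rewrite ler_pdivlMr ?exprn_gt0// mulrAC ler_wpM2r// exprn_ge0.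
apply: is_cvg_geometric_series.
rewrite ger0_norm; last by rewrite divr_ge0// ltW.
by rewrite ltr_pdivrMr// mul1r.
Qed.

Lemma radius_ge1_is_derive c x : radius_ge1 c -> `|x| < 1 ->
  is_derive x 1 (fun y => limn (pseries c y))
    (limn (pseries (pseries_diffs c) x)).
Proof.
move=> rc x1.
have [K [K0 K1 xK]] : exists K, [/\ 0 < K, K < 1 & `|x| < K].
  by exists ((`|x| + 1) / 2); have := normr_ge0 x; split; lra.
have {}K1 : `|K| < 1 by rewrite gtr0_norm.
(* This asks for convergence of the series and of its first two formal derivatives at a point [K]
   beyond |x|. *)
apply: (@pseries_snd_diffs _ _ K).
- exact: radius_ge1_cvg.
- exact/radius_ge1_cvg/K1/radius_ge1_diffs.
- exact/radius_ge1_cvg/K1/radius_ge1_diffs/radius_ge1_diffs.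
- by rewrite (gtr0_norm K0).
Qed.

End RadiusOne.

(** * Coefficients of the power series: bounds and recurrences *)

Section Coefficients.
Context {R : realType}.
Implicit Types (b : bool) (c : seq nat) (n : nat) (z : R).

(* The coefficient of [z ^+ n] in [Li] ([b = false]) or [A] ([b = true]) at the
   index list [rev c], outermost index first; [b.+1] is the factor 1 or 2 that
   each summation carries. *)
Fixpoint mcoef b c n : R :=
  if c is k :: c' then
    b.+1%:R * (b ==> (n == (size c').+1 %[mod 2]))%:R
      * (\sum_(m < n) mcoef b c' m) / n%:R ^+ k
  else (n == 0%N)%:R.

Lemma mcoef_cons b k c n : mcoef b (k :: c) n =
  b.+1%:R * (b ==> (n == (size c).+1 %[mod 2]))%:R
    * (\sum_(m < n) mcoef b c m) / n%:R ^+ k.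
Proof. by []. Qed.

Lemma mcoef_ge0 b c n : 0 <= mcoef b c n.
Proof.
elim: c n => [|k c IHc] n /=; first exact: ler0n.
by rewrite !mulr_ge0 ?ler0n ?invr_ge0 ?exprn_ge0 ?ler0n ?sumr_ge0.
Qed.

Lemma mcoef_eq0 c n : (n != size c %[mod 2])%N -> mcoef true c n = 0.
Proof.
case: c => [|k c] /=; last by move/negPf->; rewrite mulr0 !mul0r.
by case: n.
Qed.

Lemma mcoef_at0 b k c : mcoef b (k :: c) 0 = 0.
Proof. by rewrite /= big_ord0 mulr0 mul0r. Qed.

(** The inner sum has [n] terms, each bounded by induction, and dividing by [n ^ k] with k >= 1
    compensates for their number. *)
Lemma mcoef_le b c n : all (leq 1) c -> mcoef b c n <= b.+1%:R ^+ size c.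
Proof.
elim: c n => [|k c IHc] n /=; first by rewrite expr0; case: n.
case/andP; case: k => // k _ c1.
case: n => [|n]; first by rewrite big_ord0 mulr0 mul0r exprn_ge0.
have n1 : 0 < n.+1%:R ^+ k.+1 :> R by rewrite exprn_gt0.
rewrite ler_pdivrMr// -mulrA exprS -!mulrA ler_wpM2l//.
apply: (@le_trans _ _ (\sum_(m < n.+1) b.+1%:R ^+ size c)).
  apply: (@le_trans _ _ (\sum_(m < n.+1) mcoef b c m)).
    rewrite ler_piMl ?lern1 ?leq_b1//.
    by rewrite sumr_ge0// => m _; exact: mcoef_ge0.
  by apply: ler_sum => m _; exact: IHc.
rewrite sumr_const card_ord -[leLHS]mulr_natr ler_wpM2l ?exprn_ge0//.
by rewrite exprS ler_peMr// exprn_ege1// ler1n.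
Qed.

Lemma mcoef_le_nseq1 b c n : all (leq 1) c ->
  mcoef b c n <= mcoef b (nseq (size c) 1%N) n.
Proof.
elim: c n => [//|k c IHc] n /= /andP[k0 c1]; rewrite size_nseq.
have S0 d : 0 <= \sum_(m < n) mcoef b d m.
  by rewrite sumr_ge0// => m _; exact: mcoef_ge0.
apply: ler_pM.
- by rewrite !mulr_ge0 ?ler0n.
- by rewrite invr_ge0 exprn_ge0.
- by rewrite ler_wpM2l ?mulr_ge0 ?ler0n//; apply: ler_sum => m _; exact: IHc.
(* At [n = 0] both inverses are 0, because both exponents are positive and 0 has inverse 0. *)
case: n {S0} => [|n]; first by rewrite expr1 expr0n eqn0Ngt k0 invr0.
rewrite lef_pV2 ?posrE ?exprn_gt0//.
by rewrite ler_weXn2l ?ler1n.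
Qed.

Lemma radius_ge1_mcoef b c : all (leq 1) c -> radius_ge1 (mcoef b c).
Proof.
move=> c1; apply: (@bounded_radius_ge1 _ _ (b.+1%:R ^+ size c)) => n.
by rewrite ger0_norm ?mcoef_ge0// mcoef_le.
Qed.

Lemma diffs_mcoefS b k c n :
  pseries_diffs (mcoef b (k.+2 :: c)) n = mcoef b (k.+1 :: c) n.+1.
Proof.
rewrite /pseries_diffs /= exprS.
have : n.+1%:R != 0 :> R by rewrite pnatr_eq0.
by move: (n.+1%:R : R) => x x0; field; rewrite expf_neq0 x0.
Qed.

Lemma diffs_mcoef1 b c n : pseries_diffs (mcoef b (1%N :: c)) n =
  b.+1%:R * (b ==> (n == size c %[mod 2]))%:R * \sum_(m < n.+1) mcoef b c m.
Proof.
rewrite /pseries_diffs /= expr1.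
have -> : (n.+1 == (size c).+1 %[mod 2])%N = (n == size c %[mod 2])%N by lia.
by rewrite mulrC divfK// pnatr_eq0.
Qed.

(** With the next lemma, this is (1 - z^(b+1)) f' = (b+1) g coefficientwise, where g has index [c]
    and f the index with 1 appended. In degrees at most [b] the factor z^(b+1) has no effect. *)
Lemma diffs_mcoef1_small b c n : (n <= b)%N ->
  pseries_diffs (mcoef b (1%N :: c)) n = b.+1%:R * mcoef b c n.
Proof.
rewrite diffs_mcoef1 big_ord_recr /=; case: b => /=; last first.
  by case: n => // _; rewrite big_ord0 add0r !mulr1.
move=> n1; case: (boolP (n == size c %[mod 2])%N) => nc; last first.
  by rewrite (mcoef_eq0 nc) !mulr0 mul0r.
rewrite mulr1; case: n n1 nc => [|[|//]] _ nc; first by rewrite big_ord0 add0r.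
rewrite big_ord_recr big_ord0 /= add0r mcoef_eq0 ?add0r//.
by apply/negP; lia.
Qed.

(** For [b = true] the inner sum gains two terms, one of which has the wrong parity and vanishes. *)
Lemma diffs_mcoef1_step b c n :
  pseries_diffs (mcoef b (1%N :: c)) (n + b.+1) =
  pseries_diffs (mcoef b (1%N :: c)) n + b.+1%:R * mcoef b c (n + b.+1).
Proof.
rewrite !diffs_mcoef1; case: b => /=.
  rewrite (_ : (n + 2).+1 = n.+3)%N; last by lia.
  rewrite addn2 (_ : (n.+2 == size c %[mod 2])%N = (n == size c %[mod 2])%N);
    last by lia.
  rewrite [in LHS]big_ord_recr [in LHS]big_ord_recr /=.
  case: (boolP (n == size c %[mod 2])%N) => nc.
    by rewrite mulr1 (@mcoef_eq0 c n.+1) ?addr0 -?mulrDr//; lia.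
  by rewrite (@mcoef_eq0 c n.+2) ?mulr0 ?mul0r ?addr0//; lia.
by rewrite addn1 big_ord_recr/= mulrDr !mulr1.
Qed.

End Coefficients.

Arguments mcoef {R} b c n : simpl never.

(** * The functions Li and A on the open unit interval and their derivatives *)

Section MultiplePolylog.
Context {R : realType}.
Local Open Scope classical_set_scope.
Implicit Types (b : bool) (c : seq nat) (z : R).

Lemma eq_cvgn (u v : nat -> R) (l : R) :
  u =1 v -> u n @[n --> \oo] --> l -> v n @[n --> \oo] --> l.
Proof. by move=> /funext ->. Qed.

Definition mpl b c z : R := limn (pseries (mcoef b c) z).

Lemma mpl_cvg b c z : all (leq 1) c -> `|z| < 1 -> cvgn (pseries (mcoef b c) z).
Proof. by move=> c1; apply: radius_ge1_cvg; exact: radius_ge1_mcoef. Qed.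

Lemma mpl_diffs_cvg b c z : all (leq 1) c -> `|z| < 1 ->
  cvgn (pseries (pseries_diffs (mcoef b c)) z).
Proof.
move=> c1; apply/radius_ge1_cvg/radius_ge1_diffs; exact: radius_ge1_mcoef.
Qed.

Lemma mpl_nil b z : mpl b [::] z = 1.
Proof.
rewrite /mpl; apply: cvg_lim => //; rewrite -cvg_shiftS/=.
rewrite [X in X @ _ --> _](_ : _ = fun=> 1); first exact: cvg_cst.
apply/funext => n; rewrite /pseries /series/= big_nat_recl// expr0 mulr1.
by rewrite big1 ?addr0// => i _; rewrite mul0r.
Qed.

Lemma mpl_at0 b k c : mpl b (k :: c) 0 = 0.
Proof.
rewrite /mpl; apply: cvg_lim => //.
rewrite [X in X @ _ --> _](_ : _ = fun=> 0); first exact: cvg_cst.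
apply/funext => n; rewrite /pseries /series/= big1// => -[_|i _].
  by rewrite mcoef_at0 mul0r.
by rewrite expr0n mulr0.
Qed.

Lemma mpl_ge0 b c z : all (leq 1) c -> 0 <= z -> z < 1 -> 0 <= mpl b c z.
Proof.
move=> c1 z0 z1; apply: limr_ge; first by apply: mpl_cvg; rewrite ?ger0_norm.
apply: nearW => n; rewrite /pseries /series/= sumr_ge0// => i _.
by rewrite mulr_ge0 ?mcoef_ge0 ?exprn_ge0.
Qed.

Lemma mpl_le_nseq1 b c z : all (leq 1) c -> 0 <= z -> z < 1 ->
  mpl b c z <= mpl b (nseq (size c) 1%N) z.
Proof.
move=> c1 z0 z1; have z1' : `|z| < 1 by rewrite ger0_norm.
apply: ler_lim; [exact: mpl_cvg|apply: mpl_cvg => //; exact: all_leq1_nseq1|].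
apply: nearW => n; rewrite /pseries /series/= ler_sum// => i _.
by rewrite ler_wpM2r ?exprn_ge0// mcoef_le_nseq1.
Qed.

(** Multiplication by [z] shifts the coefficients by one place, and the constant term on the right
    is 0. *)
Lemma mpl_diffsS b k c z : all (leq 1) c -> `|z| < 1 ->
  z * limn (pseries (pseries_diffs (mcoef b (k.+2 :: c))) z) =
  mpl b (k.+1 :: c) z.
Proof.
move=> c1 z1; apply/esym/cvg_lim => //; rewrite -cvg_shiftS.
apply: eq_cvgn (cvgM (cvg_cst z) (@mpl_diffs_cvg b (k.+2 :: c) z c1 z1)) => n.
rewrite /pseries /series/= [RHS]big_nat_recl// mcoef_at0 mul0r add0r.
rewrite /GRing.mul_fun/= big_distrr/=; apply: eq_bigr => i _.
by rewrite diffs_mcoefS exprS mulrCA.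
Qed.

Lemma mpl_diffs1 b c z : all (leq 1) c -> `|z| < 1 ->
  (1 - z ^+ b.+1) * limn (pseries (pseries_diffs (mcoef b (1%N :: c))) z) =
  b.+1%:R * mpl b c z.
Proof.
move=> c1 z1.
have dcvg := @mpl_diffs_cvg b (1%N :: c) z c1 z1.
have mcvg := @mpl_cvg b c z c1 z1.
apply/eqP; rewrite mulrBl mul1r subr_eq; apply/eqP.
move: dcvg mcvg; set d := pseries_diffs _ => dcvg mcvg.
have L : pseries d z (n + b.+1)%N @[n --> \oo] --> limn (pseries d z).
  by rewrite (cvg_shiftn b.+1 (pseries d z)).
apply: (cvg_unique _ L) => //=.
have L2 : pseries (mcoef b c) z (n + b.+1)%N @[n --> \oo] --> mpl b c z.
  by rewrite (cvg_shiftn b.+1 (pseries (mcoef b c) z)).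
have H1 : b.+1%:R * pseries (mcoef b c) z (n + b.+1)%N @[n --> \oo] -->
  b.+1%:R * mpl b c z by exact: cvgM (cvg_cst _) L2.
have H2 : z ^+ b.+1 * pseries d z n @[n --> \oo] -->
  z ^+ b.+1 * limn (pseries d z) by exact: cvgM (cvg_cst _) dcvg.
apply: eq_cvgn (cvgD H1 H2) => n; rewrite /GRing.add_fun/=.
rewrite /pseries/=.
(* The first [b.+1] terms are matched by [diffs_mcoef1_small], the shifted remainder by
   [diffs_mcoef1_step]. *)
have E (u : nat -> R) : series u (n + b.+1)%N =
    \sum_(0 <= i < b.+1) u i + \sum_(0 <= i < n) u (i + b.+1)%N.
  by rewrite /series/= addnC (@big_cat_nat _ _ _ b.+1)//= ?leq_addr//
    -{2}[b.+1]add0n big_addn addKn.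
rewrite !E mulrDr -addrA; congr (_ + _).
  rewrite mulr_sumr !big_mkord; apply: eq_bigr => i _.
  by rewrite mulrA /d diffs_mcoef1_small// -ltnS.
rewrite /series/= !mulr_sumr -big_split; apply: eq_bigr => i _ /=.
by rewrite /d diffs_mcoef1_step exprD; ring.
Qed.

Lemma is_derive_mpl b c z : all (leq 1) c -> `|z| < 1 ->
  is_derive z 1 (mpl b c) (limn (pseries (pseries_diffs (mcoef b c)) z)).
Proof. by move=> c1; apply: radius_ge1_is_derive; exact: radius_ge1_mcoef. Qed.

End MultiplePolylog.

(** * Identification of the multiple sums with power series *)

Section PartialSums.

(** Splits off the outermost summation index, as the recursion of [mcoef] does. *)
Lemma sum_tuple_rcons {V : nmodType} {T : finType} (r : nat)
    (P : pred (r.+1.-tuple T)) (F : r.+1.-tuple T -> V) :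
  \sum_(s | P s) F s =
  \sum_x \sum_(s : r.-tuple T | P [tuple of rcons s x]) F [tuple of rcons s x].
Proof.
rewrite pair_big_dep/=.
pose f (p : T * r.-tuple T) := [tuple of rcons p.2 p.1].
pose g (s : r.+1.-tuple T) :=
  (tnth s ord_max, [tuple tnth s (widen_ord (leqnSn r) i) | i < r]).
have f_widen p i : tnth (f p) (widen_ord (leqnSn r) i) = tnth p.2 i.
  by rewrite (tnth_nth p.1) [RHS](tnth_nth p.1)/= nth_rcons size_tuple ltn_ord.
have f_max p : tnth (f p) ord_max = p.1.
  by rewrite (tnth_nth p.1)/= nth_rcons size_tuple ltnn eqxx.
rewrite (reindex f)//; exists g => [[x s] _|s _].
  rewrite /g f_max; congr (_, _); apply: eq_from_tnth => i.
  by rewrite tnth_mktuple f_widen.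
apply: eq_from_tnth => i; case: (unliftP ord_max i) => [j ->|->].
  have -> : lift ord_max j = widen_ord (leqnSn r) j by exact/val_inj/lift_max.
  by rewrite f_widen tnth_mktuple.
by rewrite f_max.
Qed.

Context {R : realType}.
Implicit Types (b : bool) (ks : seq nat) (z : R).

(** The weight [F] is arbitrary for the sake of the induction: the inner sum is an instance whose
    weight is the indicator of m < x. *)
Lemma sum_multi_indices b (r N : nat) (kf : nat -> nat) (F : nat -> R) :
  b.+1%:R ^+ r *
  \sum_(n : r.-tuple 'I_N.+1 | path ltn 0%N (map val n) &&
      (b ==> [forall i : 'I_r, tnth n i == i.+1 %[mod 2]]))
    F (last 0%N (map val n)) / \prod_(i < r) (tnth n i)%:R ^+ kf i =
  \sum_(n < N.+1) mcoef b (rev (mkseq kf r)) n * F n.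
Proof.
elim: r F => [|r IHr] F.
  (* For [r = 0] the default of [last] gives the value [F 0], matching the coefficients of the empty
     index. *)
  rewrite expr0 mul1r (big_pred1 [tuple]) => [|n]; last first.
    rewrite [n]tuple0 [RHS]eqxx /=; apply/implyP => _; apply/forallP => i.
    by have := ltn_ord i.
  rewrite big_ord0 divr1 big_ord_recl /= big1 => [|i _]; last by rewrite mul0r.
  by rewrite mul1r addr0.
rewrite sum_tuple_rcons exprS -mulrA !mulr_sumr; apply: eq_bigr => x _.
(* [w] collects what depends on the outermost index [x] alone; in [v] the condition that the
   previous index is below [x] has become a weight. *)
pose w := (b ==> (x == r.+1 %[mod 2]))%:R * (F x / x%:R ^+ kf r).
pose A (s : r.-tuple 'I_N.+1) := path ltn 0%N (map val s) &&
  (b ==> [forall i : 'I_r, tnth s i == i.+1 %[mod 2]]).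
pose v : R := \sum_(s : r.-tuple 'I_N.+1 | A s)
  (last 0%N (map val s) < x)%N%:R / \prod_(i < r) (tnth s i)%:R ^+ kf i.
rewrite (_ : \sum_(s | _) _ = w * v).
  rewrite (_ : b.+1%:R * _ = b.+1%:R * w * (b.+1%:R ^+ r * v)); last by ring.
  rewrite (IHr (fun m => (m < x)%N%:R)) mkseqS rev_rcons mcoef_cons.
  rewrite (big_ord_widen N.+1 (mcoef b (rev (mkseq kf r))) (ltnW (ltn_ord x))).
  rewrite [in RHS]big_mkcond size_rev size_mkseq /=.
  rewrite [X in _ = _ * X / _ * _](_ : _ =
    \sum_(m < N.+1) mcoef b (rev (mkseq kf r)) m * (m < x)%N%:R).
    by rewrite /w; ring.
  by apply: eq_bigr => m _; case: ifP; rewrite ?mulr1 ?mulr0.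
rewrite /v mulr_sumr [LHS]big_mkcond [RHS]big_mkcond; apply: eq_bigr => s _.
rewrite /A /= map_rcons rcons_path last_rcons big_ord_recr /=.
have tnth_widen i :
    tnth [tuple of rcons s x] (widen_ord (leqnSn r) i) = tnth s i.
  by rewrite (tnth_nth x) [RHS](tnth_nth x)/= nth_rcons size_tuple ltn_ord.
have tnth_max : tnth [tuple of rcons s x] ord_max = x.
  by rewrite (tnth_nth x)/= nth_rcons size_tuple ltnn eqxx.
have prodE :
    \prod_(i < r)
      (tnth [tuple of rcons s x] (widen_ord (leqnSn r) i))%:R ^+ kf i = \prod_(i < r) (tnth s i)%:R ^+ kf i :> R.
  by apply: eq_bigr => i _; rewrite tnth_widen.
rewrite tnth_max prodE.
rewrite (_ : [forall i : 'I_r.+1, _] =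
  [forall i : 'I_r, tnth s i == i.+1 %[mod 2]] && (x == r.+1 %[mod 2]));
  last first.
  apply/forallP/andP => [H|[/forallP H1 H2] i].
    split; last by have := H ord_max; rewrite tnth_max.
    apply/forallP => i.
    by have := H (widen_ord (leqnSn r) i); rewrite tnth_widen.
  case: (unliftP ord_max i) => [j ->|->]; last by rewrite tnth_max.
  have -> : lift ord_max j = widen_ord (leqnSn r) j by exact/val_inj/lift_max.
  by rewrite tnth_widen.
rewrite /w; case: (path _ _ _) => //=.
case: (last _ _ < x)%N => /=; last by case: ifP; rewrite ?mul0r ?mulr0.
case: b {IHr w A v} => /=; last by rewrite invfM; ring.
case: [forall _, _] => //=.
case: (x == _ %[mod 2]) => /=; last by rewrite !mul0r.
by rewrite invfM; ring.
Qed.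

Local Open Scope classical_set_scope.

(** Dividing by [a] makes [u] a convergent sequence. The bound n <= N corresponds to the partial sum
    of length [N.+1]. *)
Lemma limn_partial_sums b ks z (u : nat -> R) (a : R) : all (leq 1) ks ->
  `|z| < 1 -> a != 0 ->
  (forall N, a * u N = \sum_(n < N.+1) mcoef b (rev ks) n * z ^+ n) ->
  a * limn u = mpl b (rev ks) z.
Proof.
move=> k1 z1 a0 uE; apply: (mulfI (invr_neq0 a0)); rewrite mulKf//.
apply: cvg_lim => //.
have H : cvgn (pseries (@mcoef R b (rev ks)) z).
  by apply: mpl_cvg => //; rewrite all_rev.
have HS : pseries (mcoef b (rev ks)) z N.+1 @[N --> \oo] --> mpl b (rev ks) z.
  by rewrite (cvg_shiftS (pseries _ z)).
have HZ : a^-1 * pseries (mcoef b (rev ks)) z N.+1 @[N --> \oo] -->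
  a^-1 * mpl b (rev ks) z by exact: cvgM (cvg_cst _) HS.
apply: eq_cvgn HZ => N; rewrite -[RHS](mulKf a0) uE.
by rewrite /pseries /series/= big_mkord.
Qed.

Lemma polylogE ks z : all (leq 1) ks -> `|z| < 1 ->
  polylog ks z = mpl false (rev ks) z.
Proof.
move=> k1 z1; rewrite -[LHS]mul1r.
apply: limn_partial_sums => // N.
have := sum_multi_indices false (size ks) N (nth 0%N ks) (fun m => z ^+ m).
rewrite mkseq_nth => <-; rewrite expr1n; congr (_ * _).
by apply: eq_bigl => n; rewrite andbT.
Qed.

Lemma ApolylogE ks z : all (leq 1) ks -> `|z| < 1 ->
  Apolylog ks z = mpl true (rev ks) z.
Proof.
move=> k1 z1; apply: limn_partial_sums => // N.
have := sum_multi_indices true (size ks) N (nth 0%N ks) (fun m => z ^+ m).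
by rewrite mkseq_nth.
Qed.

End PartialSums.

(** * Integrals over the half-line *)

Section GammaInteger.
Context {R : realType}.
Local Open Scope classical_set_scope.
Local Notation mu := (@lebesgue_measure R).
Local Notation pos := (`]0%R, +oo[ : set R).
Implicit Types (t : R) (n : nat).

Lemma measurable_fun_pos (f : R -> R) :
  (forall t, 0 < t -> {for t, continuous f}) -> measurable_fun pos f.
Proof.
move=> cf; apply: open_continuous_measurable_fun; first exact: interval_open.
by move=> t; rewrite inE/= in_itv/= andbT; exact: cf.
Qed.

(** Since t^n/n! is (n+1)/t times t^(n+1)/(n+1)!, and exp(-t) t^(n+1)/(n+1)! <= 1, the product is at
    most (n+1)/t. *)
Lemma expRN_divpow_cvg n : expR (- t) * divpow n t @[t --> +oo] --> (0 : R).
Proof.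
apply/cvgrPdist_lt => e e0; near=> t.
have t0 : 0 < t by near: t; exact: nbhs_pinfty_gt.
have te : n.+1%:R / e < t by near: t; apply: nbhs_pinfty_gt; exact: num_real.
have d0 : 0 <= divpow n t by rewrite divpow_ge0// ltW.
rewrite sub0r normrN ger0_norm; last by rewrite (mulr_ge0 (expR_ge0 _) d0).
have E : divpow n t = n.+1%:R / t * divpow n.+1 t.
  rewrite /divpow factS natrM exprS; field.
  by rewrite pnatr_eq0 -lt0n fact_gt0 nat1r pnatr_eq0 (gt_eqF t0).
have le1 : expR (- t) * divpow n.+1 t <= 1.
  rewrite expRN mulrC ler_pdivrMr ?expR_gt0// mul1r.
  by apply: le_trans (expR_ge1Dxn n (ltW t0)); rewrite lerDr.
apply: (@le_lt_trans _ _ (n.+1%:R / t)).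
  by rewrite E mulrCA ler_piMr// divr_ge0 ?ler0n ?ltW.
by rewrite ltr_pdivrMr// mulrC -ltr_pdivrMr.
Unshelve. all: by end_near. Qed.

Lemma is_derive_expRN t : is_derive t 1 (fun t => expR (- t)) (- expR (- t)).
Proof.
have H := is_derive1_comp (is_derive_expR (- t)) (is_deriveNid t 1).
by apply: is_derive_eq H _; rewrite mulrN1.
Qed.

Lemma has_deriv_expRN : has_deriv (fun t => expR (- t)) (fun t => - expR (- t)).
Proof.
by split=> t _; have ? := is_derive_expRN t; [exact: ex_derive|].
Qed.

(** An antiderivative of exp(-t) t^n/n! with value -1 at 0 and limit 0 at infinity. *)
Let F n t : R := - (expR (- t) * \sum_(i < n.+1) divpow i t).

Let has_deriv_F n : has_deriv (F n) (fun t => expR (- t) * divpow n t).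
Proof.
elim: n => [|n IHn].
  have -> : F 0 = fun t => (fun=> -1) t * expR (- t).
    by apply/funext => t; rewrite /F big_ord1 divpow0 mulr1 mulN1r.
  apply: has_deriv_ext _ (has_derivM (has_deriv_cst _) has_deriv_expRN) => t _.
  by rewrite divpow0; ring.
have -> : F n.+1 = fun t => F n t + (fun=> -1) t * (expR (- t) * divpow n.+1 t).
  by apply/funext => t; rewrite /F big_ord_recr/=; ring.
apply: has_deriv_ext _ (has_derivD IHn (has_derivM (has_deriv_cst _)
  (has_derivM has_deriv_expRN (has_deriv_divpow n)))) => t _.
by ring.
Qed.

Let F_cvg n : F n t @[t --> +oo] --> (0 : R).
Proof.
have N m : - (expR (- t) * divpow m t) @[t --> +oo] --> (0 : R).
  by rewrite -oppr0; apply: cvgN; exact: expRN_divpow_cvg.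
elim: n => [|n IHn].
  by rewrite /F; under eq_fun do rewrite big_ord1; exact: N.
rewrite /F; under eq_fun do rewrite big_ord_recr mulrDr opprD.
by rewrite -[X in nbhs X]addr0; apply: cvgD; [exact: IHn|exact: N].
Qed.

Lemma integral_expRN_divpow n :
  (\int[mu]_(t in pos) (expR (- t) * divpow n t)%:E = 1)%E.
Proof.
have dF := has_deriv_F n.
have cf t : 0 <= t -> {for t, continuous (fun t => expR (- t) * divpow n t)}.
  exact: has_deriv_continuous (has_derivM has_deriv_expRN
    (has_deriv_divpow_pred n)).
rewrite integral_itv_obnd_cbnd; last first.
  by apply/measurable_EFinP; apply: measurable_fun_pos => t /ltW; exact: cf.
rewrite (@ge0_continuous_FTC2y _ _ (F n) 0 0).
- rewrite /F oppr0 expR0 mul1r big_ord_recl/= divpow0 big1; last first.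
    by move=> i _; rewrite divpowS0.
  by rewrite addr0 -EFinB sub0r opprK.
- by move=> t t0; rewrite (mulr_ge0 (expR_ge0 _) (divpow_ge0 _ _)).
- apply: continuous_in_subspaceT => t.
  by rewrite inE/= in_itv/= andbT; exact: cf.
- exact: F_cvg.
- by move=> t t0; case: dF => dF _; apply: dF; exact: ltW.
- by apply: cvg_at_right_filter; exact: has_deriv_continuous dF _.
- move=> t; rewrite in_itv/= andbT => t0.
  by rewrite derive1E; case: dF => _ /(_ _ t0) H; exact: derive_val.
Qed.

Lemma integrable_expRN_divpow n :
  mu.-integrable pos (EFin \o (fun t => expR (- t) * divpow n t)).
Proof.
apply/integrableP; split.
  apply/measurable_EFinP; apply: measurable_fun_pos => t t0.
  exact: has_deriv_continuous (has_derivM has_deriv_expRN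
    (has_deriv_divpow_pred n)) (ltW t0).
apply: le_lt_trans (ltry (1 : R)); rewrite -(integral_expRN_divpow n).
rewrite le_eqVlt; apply/orP; left; apply/eqP; apply: eq_integral => t.
rewrite inE/= in_itv/= andbT => t0; congr _%:E; rewrite ger0_norm//.
by rewrite mulr_ge0 ?expR_ge0// divpow_ge0// ltW.
Qed.

Lemma Gamma_nat n : Gamma n.+1%:R = n`!%:R :> R.
Proof.
rewrite /Gamma (@eq_Rintegral _ _ _ mu _
    (fun t => n`!%:R * (expR (- t) * divpow n t))).
  rewrite RintegralZl//; last exact: integrable_expRN_divpow.
  by rewrite /Rintegral integral_expRN_divpow mulr1.
move=> t; rewrite inE/= in_itv/= andbT => t0.
rewrite -natr1 addrK powR_mulrn ?ltW// /divpow; field.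
by rewrite pnatr_eq0 -lt0n fact_gt0.
Qed.

End GammaInteger.

(** Integrability and value are proved together: additivity needs the tail to be integrable, and
    nested sums reuse the first part. *)
Lemma Rintegral_lincomb d (T : measurableType d) (R : realType)
    (mu : {measure set T -> \bar R}) (D : set T) (I : eqType) (s : seq I)
    (a : I -> R) (f : I -> T -> R) : measurable D ->
  {in s, forall i, mu.-integrable D (EFin \o f i)} ->
  mu.-integrable D (EFin \o (fun t => \sum_(i <- s) a i * f i t)) /\
  \int[mu]_(t in D) (\sum_(i <- s) a i * f i t) =
  \sum_(i <- s) a i * \int[mu]_(t in D) f i t.
Proof.
move=> mD; elim: s => [_|i s IHs fs].
  rewrite big_nil; under [in X in _ /\ X]eq_Rintegral do rewrite big_nil.
  rewrite Rintegral_cst// mul0r; split => //.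
  by under eq_fun do rewrite big_nil; exact: integrable0.
have [iS Es] : _ /\ _ := IHs (fun j js => fs j (@mem_behead _ (i :: s) j js)).
have ii : mu.-integrable D (EFin \o (fun t => a i * f i t)).
  have H := integrableZl mD (a i) (fs i (mem_head _ _)).
  by apply: (eq_integrable mD _ _ _ H).
split.
  apply: (eq_integrable mD _ _ _ (integrableD mD ii iS)) => t _ /=.
  by rewrite big_cons EFinD.
under eq_Rintegral do rewrite big_cons.
rewrite RintegralD// RintegralZl ?Es ?big_cons//.
by apply: fs; rewrite mem_head.
Qed.

(** * Moments for a general substitution z(t) *)

Section Kernel.
Context {R : realType} (b : bool) (zf : R -> R).
Local Open Scope classical_set_scope.
Local Notation mu := (@lebesgue_measure R).
Local Notation pos := (`]0%R, +oo[ : set R).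
Implicit Types (t : R) (c : seq nat) (q : nat).

(* The hypothesis [is_derive_zf] below makes this z'/z. *)
Definition kernel (t : R) : R := (1 - zf t ^+ b.+1) / b.+1%:R / zf t.

Hypothesis zf0 : zf 0 = 0.
Hypothesis zf_gt0 : forall t, 0 < t -> 0 < zf t.
Hypothesis zf_lt1 : forall t, zf t < 1.
Hypothesis is_derive_zf : forall t, 0 <= t ->
  is_derive t 1 zf ((1 - zf t ^+ b.+1) / b.+1%:R).
Hypothesis kernel_le : forall t, 0 < t ->
  t * kernel t <= 2 * (1 + t) * expR (- t).

Definition mpl_at (c : seq nat) (t : R) : R := mpl b c (zf t).

Lemma zf_ge0 t : 0 <= t -> 0 <= zf t.
Proof. by rewrite le_eqVlt => /predU1P[<-|/zf_gt0/ltW//]; rewrite zf0. Qed.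

Lemma zf_norm_lt1 t : 0 <= t -> `|zf t| < 1.
Proof. by move=> t0; rewrite ger0_norm ?zf_ge0. Qed.

Lemma kernel_ge0 t : 0 < t -> 0 <= kernel t.
Proof.
move=> t0; rewrite /kernel !divr_ge0// ?zf_ge0 ?(ltW t0)//.
by rewrite subr_ge0 exprn_ile1 ?zf_ge0 ?(ltW t0) ?(ltW (zf_lt1 t)).
Qed.

Lemma mpl_at_nil t : mpl_at [::] t = 1.
Proof. exact: mpl_nil. Qed.

Lemma mpl_at_at0 k c : mpl_at (k :: c) 0 = 0.
Proof. by rewrite /mpl_at zf0 mpl_at0. Qed.

Lemma is_derive_mpl_at c t : all (leq 1) c -> 0 <= t ->
  is_derive t 1 (mpl_at c) (limn (pseries (pseries_diffs (mcoef b c)) (zf t)) *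
    ((1 - zf t ^+ b.+1) / b.+1%:R)).
Proof.
move=> c1 t0; have zD := is_derive_zf t0.
have mD := is_derive_mpl b c1 (zf_norm_lt1 t0).
exact: is_derive1_comp.
Qed.

(** By the chain rule: z' = (1 - z^(b+1))/(b+1) is exactly the factor occurring in [mpl_diffs1]. *)
Lemma has_deriv_mpl_at1 c : all (leq 1) c ->
  has_deriv (mpl_at (1%N :: c)) (mpl_at c).
Proof.
move=> c1; have D t : 0 <= t -> is_derive t 1 (mpl_at (1%N :: c)) (mpl_at c t).
  move=> t0; apply: is_derive_eq (@is_derive_mpl_at (1%N :: c) t c1 t0) _.
  rewrite mulrA [_ * (1 - _)]mulrC mpl_diffs1 ?zf_norm_lt1//.
  by rewrite mulrAC divff ?mul1r.
by split=> t t0; [have ? := D _ t0; exact: ex_derive|exact/D/ltW].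
Qed.

Lemma has_deriv_mpl_atS k c : all (leq 1) c -> has_deriv (mpl_at (k.+2 :: c))
  (fun t => kernel t * mpl_at (k.+1 :: c) t).
Proof.
move=> c1; split=> t t0.
  by have ? := @is_derive_mpl_at (k.+2 :: c) t c1 t0; exact: ex_derive.
apply: is_derive_eq (@is_derive_mpl_at (k.+2 :: c) t c1 (ltW t0)) _.
rewrite /mpl_at -(mpl_diffsS b k c1 (zf_norm_lt1 (ltW t0))) /kernel.
rewrite mulrA divfK ?gt_eqF ?zf_gt0//; first by rewrite mulrC.
Qed.

Lemma mpl_at_ge0 c t : all (leq 1) c -> 0 <= t -> 0 <= mpl_at c t.
Proof. by move=> c1 t0; rewrite /mpl_at mpl_ge0 ?zf_ge0. Qed.

(* Lowering every index to 1 can only increase the coefficients, and the index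
   {1}_r is t^r/r! exactly. *)
Lemma mpl_at_le c t : all (leq 1) c -> 0 <= t ->
  mpl_at c t <= divpow (size c) t.
Proof.
move=> c1 t0; rewrite -(Phi_nseq1 mpl_at_nil mpl_at_at0 has_deriv_mpl_at1)//.
by rewrite /mpl_at mpl_le_nseq1 ?zf_ge0.
Qed.

Definition moment_fun (c : seq nat) (q : nat) (t : R) : R :=
  t ^+ q * (kernel t * mpl_at c t).

Lemma moment_fun_continuous c q t : all (leq 1) c -> 0 < t ->
  {for t, continuous (moment_fun c q)}.
Proof.
move=> c1 t0; have t0' := ltW t0.
have cz : {for t, continuous zf}.
  apply/differentiable_continuous/derivable1_diffP.
  by have ? := is_derive_zf t0'; exact: ex_derive.
have cm : {for t, continuous (mpl_at c)}.
  apply/differentiable_continuous/derivable1_diffP.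
  by have ? := is_derive_mpl_at c1 t0'; exact: ex_derive.
apply: continuousM; first exact: exprn_continuous.
apply: continuousM cm; apply: continuousM; last first.
  by apply: continuousV cz; rewrite gt_eqF ?zf_gt0.
apply: continuousM; last exact: cst_continuous.
apply: continuousB; first exact: cst_continuous.
apply: (@continuous_comp _ _ _ zf (fun x => x ^+ b.+1) _ cz).
exact: exprn_continuous.
Qed.

(** For a nonempty index [mpl_at_le] supplies at least one factor t, which absorbs the pole of the
    kernel at 0; by [kernel_le] the rest is dominated by a polynomial times exp(-t). *)
Lemma integrable_moment_fun c q : all (leq 1) c -> c != [::] ->
  mu.-integrable pos (EFin \o moment_fun c q).
Proof.
move=> c1; have := mpl_at_le c1; case: (c) c1 => // k c' c1 mle _.
set n := size c' in mle; pose m := (q + size c')%N.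
pose g i t : R := expR (- t) * divpow i t.
(* Chosen so that [M i * g i t] is 2 t^i exp(-t). *)
pose M i : R := 2 * i`!%:R.
have ig : mu.-integrable pos
    (EFin \o (fun t => M m * g m t + M m.+1 * g m.+1 t)).
  have iM i : mu.-integrable pos (EFin \o (fun t => M i * g i t)).
    have H := @integrable_expRN_divpow R i.
    by apply: (eq_integrable _ _ _ _ (integrableZl _ (M i) H)).
  by apply: (eq_integrable _ _ _ _ (integrableD _ (iM m) (iM m.+1))).
apply: le_integrable ig => //.
  apply/measurable_EFinP; apply: measurable_fun_pos => t.
  exact: moment_fun_continuous.
move=> t /=; rewrite in_itv/= andbT => t0; have t0' := ltW t0.
have kge := kernel_ge0 t0; have mge := mpl_at_ge0 c1 t0'.
rewrite lee_fin ger0_norm;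
  last exact: mulr_ge0 (exprn_ge0 _ t0') (mulr_ge0 kge mge).
apply: le_trans (ler_norm _).
have -> : M m * g m t + M m.+1 * g m.+1 t =
    t ^+ q * t ^+ n * (2 * (1 + t) * expR (- t)).
  rewrite /M /g /divpow -exprD -/m exprS factS natrM.
  by field; rewrite pnatr_eq0 -lt0n fact_gt0 nat1r pnatr_eq0.
apply: (@le_trans _ _ (t ^+ q * t ^+ n * (t * kernel t))); last first.
  by rewrite ler_wpM2l ?mulr_ge0 ?exprn_ge0// kernel_le.
have -> : t ^+ q * t ^+ n * (t * kernel t) = t ^+ q * (kernel t * t ^+ n.+1).
  by rewrite exprS; ring.
rewrite /moment_fun ler_wpM2l ?exprn_ge0// ler_wpM2l//.
apply: le_trans (mle _ t0') _; rewrite /divpow ler_pdivrMr ?ltr0n ?fact_gt0//.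
by rewrite ler_peMr ?exprn_ge0// ler1n fact_gt0.
Qed.

(** The value of [xi] or [psi] at [q + 1], where Gamma is [q]!. *)
Definition moment (c : seq nat) (q : nat) : R :=
  (q`!%:R)^-1 * \int[mu]_(t in pos) moment_fun c q t.

Local Notation height_oneF := (height_one mpl_at).
Local Notation depth_sumF := (depth_sum mpl_at).

(** Turns the 1/d! of [divpow d] into a binomial coefficient, by C(q+d,q)/(q+d)! = 1/(q! d!). *)
Lemma bin_moment c q d : 'C(q + d, q)%:R * moment c (q + d) =
  q`!%:R^-1 * (d`!%:R^-1 * \int[mu]_(t in pos) moment_fun c (q + d) t).
Proof.
rewrite /moment !mulrA; congr (_ * _).
have fact0 i : i`!%:R != 0 :> R by rewrite pnatr_eq0 -lt0n fact_gt0.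
apply: (mulIf (fact0 (q + d)%N)); rewrite divfK//.
have := bin_fact (leq_addr d q); rewrite addKn => <-.
by rewrite !natrM; field; rewrite !fact0.
Qed.

Lemma mul_divpow_moment_fun c q d t :
  t ^+ q * (kernel t * (divpow d t * mpl_at c t)) =
  d`!%:R^-1 * moment_fun c (q + d) t.
Proof. by rewrite /moment_fun /divpow exprD; ring. Qed.

Lemma moment_height_one m q r :
  moment (m.+1 :: nseq r 1%N) q =
  \sum_(j < r.+1) \sum_(c <- rcompositions j.+1 m)
    (-1) ^+ j * 'C(q + (r - j), q)%:R * moment c (q + (r - j)).
Proof.
pose a (j : 'I_r.+1) : R := (-1) ^+ j / (r - j)`!%:R.
(* The coefficient 1 gives the inner sum the shape that [Rintegral_lincomb] expects. *)
pose f (j : 'I_r.+1) t :=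
  \sum_(c <- rcompositions j.+1 m) 1 * moment_fun c (q + (r - j)) t.
have int_f j : {in rcompositions j.+1 m, forall c d,
    mu.-integrable pos (EFin \o moment_fun c d)}.
  move=> c; rewrite mem_rcompositions => /and3P[/eqP cj c1 _] d.
  by apply: integrable_moment_fun => //; case: c cj {c1}.
rewrite /moment (@eq_Rintegral _ _ _ mu _ (fun t => \sum_j a j * f j t)).
  have [|_ ->] := @Rintegral_lincomb _ _ _ mu pos _ (index_enum 'I_r.+1) a f
    (measurable_itv _).
    move=> j _; have [|H _] := @Rintegral_lincomb _ _ _ mu pos _
      (rcompositions j.+1 m) (fun=> 1)
      (fun c => moment_fun c (q + (r - j))) (measurable_itv _); last exact: H.
    by move=> c cj; exact: int_f cj _.
  rewrite mulr_sumr; apply: eq_bigr => j _.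
  have [|_ ->] := @Rintegral_lincomb _ _ _ mu pos _ (rcompositions j.+1 m)
    (fun=> 1) (fun c => moment_fun c (q + (r - j))) (measurable_itv _).
    by move=> c cj; exact: int_f cj _.
  rewrite !mulr_sumr; apply: eq_bigr => c _.
  by rewrite -[RHS]mulrA bin_moment /a; ring.
move=> t; rewrite inE/= in_itv/= andbT => /ltW t0.
rewrite /moment_fun -[mpl_at _ t]/(height_oneF r m t).
rewrite (height_one_altconv mpl_at_nil mpl_at_at0 has_deriv_mpl_at1
  has_deriv_mpl_atS)// /altconv !mulr_sumr; apply: eq_bigr => j _.
rewrite /f /depth_sum !mulr_sumr; apply: eq_bigr => c _.
by rewrite mul1r /a -[RHS]mulrA -mul_divpow_moment_fun/=; ring.
Qed.

Lemma moment_depth_sum m q r :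
  \sum_(c <- rcompositions r.+1 m) moment c q =
  \sum_(j < r.+1) (-1) ^+ j * 'C(q + (r - j), q)%:R
    * moment (m.+1 :: nseq j 1%N) (q + (r - j)).
Proof.
pose a (j : 'I_r.+1) : R := (-1) ^+ j / (r - j)`!%:R.
pose f (j : 'I_r.+1) := moment_fun (m.+1 :: nseq j 1%N) (q + (r - j)).
rewrite /moment -mulr_sumr.
have [|_ E] := @Rintegral_lincomb _ _ _ mu pos _ (rcompositions r.+1 m)
    (fun=> 1) (fun c => moment_fun c q) (measurable_itv _).
  move=> c; rewrite mem_rcompositions => /and3P[/eqP cj c1 _].
  by apply: integrable_moment_fun => //; case: c cj {c1}.
under eq_bigr => c _ do rewrite -[Rintegral _ _ _]mul1r.
rewrite -E (@eq_Rintegral _ _ _ mu _ (fun t => \sum_j a j * f j t)).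
  have [|_ ->] := @Rintegral_lincomb _ _ _ mu pos _ (index_enum 'I_r.+1) a f
    (measurable_itv _).
    move=> j _; apply: integrable_moment_fun => //.
    exact: all_leq1_nseq1.
  rewrite mulr_sumr; apply: eq_bigr => j _.
  by rewrite -[RHS]mulrA -/(moment _ _) bin_moment /a /f; ring.
move=> t; rewrite inE/= in_itv/= andbT => /ltW t0.
transitivity (t ^+ q * (kernel t * depth_sumF r.+1 m t)).
  by rewrite /depth_sum !mulr_sumr; apply: eq_bigr => c _; rewrite mul1r.
rewrite (depth_sum_altconv mpl_at_nil mpl_at_at0 has_deriv_mpl_at1
  has_deriv_mpl_atS)// /altconv !mulr_sumr; apply: eq_bigr => j _.
rewrite /a /f -[RHS]mulrA -mul_divpow_moment_fun /height_one/=; ring.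
Qed.

(** [X] stands for [xi] or [psi]. With [k = m + 1], [p = q + 1] and depths counted from 0, these are
    the two moment identities read through [rev]. *)
Lemma duality_moment (X : seq nat -> R -> R) (k p r : nat) :
  (forall ks q, all (leq 1) ks -> ks != [::] ->
    X ks q.+1%:R = moment (rev ks) q) ->
  (0 < k)%N -> (0 < p)%N -> (0 < r)%N ->
  X (rcons (nseq (r - 1) 1%N) k) p%:R =
    \sum_(1 <= j < r.+1)
      sum_compositions j (k + j - 1) (fun ks =>
        (-1) ^+ (j - 1) * 'C(p + r - j - 1, p - 1)%:R * X ks (p + r - j)%:R) /\
  sum_compositions r (k + r - 1) (fun ks => X ks p%:R) =
    \sum_(1 <= j < r.+1)
      (-1) ^+ (j - 1) * 'C(p + r - j - 1, p - 1)%:R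
        * X (rcons (nseq (j - 1) 1%N) k) (p + r - j)%:R.
Proof.
move=> XE; case: k p r => [|m] [|q] [|r] // _ _ _.
have arith (j : 'I_r.+1) : [/\ (m.+1 + j.+1 - 1 = m + j.+1)%N,
    (q.+1 + r.+1 - j.+1 = (q + (r - j)).+1)%N & (j.+1 - 1 = j)%N].
  by have := ltn_ord j; split; lia.
have XP j s :
    X (rcons (nseq j 1%N) m.+1) s.+1%:R = moment (m.+1 :: nseq j 1%N) s.
  rewrite XE ?rev_rcons ?rev_nseq//; first by rewrite all_rcons all_leq1_nseq1.
  by case: j.
have XC j s c : c \in rcompositions j.+1 m -> X (rev c) s.+1%:R = moment c s.
  rewrite mem_rcompositions => /and3P[cj c1 _]; rewrite XE ?revK ?all_rev//.
  by rewrite -size_eq0 size_rev (eqP cj).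
rewrite !big_add1 /= !big_mkord; split.
  rewrite [in LHS]subn1 XP moment_height_one; apply: eq_bigr => j _.
  have [-> -> ->] := arith j; rewrite sum_compositionsE big_seq [RHS]big_seq.
  by apply: eq_bigr => c cj; rewrite (XC _ _ _ cj) !subn1.
rewrite (_ : m.+1 + r.+1 - 1 = m + r.+1)%N; last by lia.
rewrite sum_compositionsE big_seq.
under eq_bigr => c cj do rewrite (XC _ _ _ cj).
rewrite -big_seq moment_depth_sum; apply: eq_bigr => j _.
by have [_ -> ->] := arith j; rewrite XP !subn1.
Qed.

End Kernel.

(** * The two substitutions *)

Section Instances.
Context {R : realType}.
Implicit Types (t : R) (ks : seq nat) (q : nat).

Definition xi_arg t : R := 1 - expR (- t).

(* This is [tanh (t / 2)]. *)
Definition psi_arg t : R := (1 - expR (- t)) / (1 + expR (- t)).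

Lemma expRN_lt1 t : 0 < t -> expR (- t) < 1.
Proof. by move=> t0; rewrite expR_lt1 oppr_lt0. Qed.

Lemma mul_expRN_le1 t : (1 + t) * expR (- t) <= 1.
Proof. by rewrite expRN ler_pdivrMr ?expR_gt0// mul1r expR_ge1Dx. Qed.

Lemma xi_arg_gt0 t : 0 < t -> 0 < xi_arg t.
Proof. by move=> t0; rewrite subr_gt0 expRN_lt1. Qed.

Lemma xi_arg_lt1 t : xi_arg t < 1.
Proof. by rewrite gtrBl expR_gt0. Qed.

Lemma is_derive_xi_arg t : 0 <= t ->
  is_derive t 1 xi_arg ((1 - xi_arg t ^+ false.+1) / false.+1%:R).
Proof.
move=> _; have C : is_derive t 1 (fun=> 1 : R) (0 : R) by exact: is_derive_cst.
have H := is_deriveB C (is_derive_expRN t).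
by apply: is_derive_eq H _; rewrite /xi_arg expr1 divr1; ring.
Qed.

Lemma kernel_xi t : 0 < t -> kernel false xi_arg t = (expR t - 1)^-1.
Proof.
move=> t0; rewrite /kernel /xi_arg expRN expr1 divr1.
have e1 : 1 < expR t by rewrite expR_gt1.
by field; rewrite subr_eq0 !gt_eqF//; lra.
Qed.

Lemma kernel_xi_le t : 0 < t ->
  t * kernel false xi_arg t <= 2 * (1 + t) * expR (- t).
Proof.
move=> t0; have x1 := expRN_lt1 t0; have x0 := expR_gt0 (- t).
have tx := mul_expRN_le1 t; rewrite /kernel /xi_arg expr1 divr1.
(* From (1 + t) exp(-t) <= 1 follows t <= (1 + t)(1 - exp(-t)). *)
rewrite mulrA ler_pdivrMr ?subr_gt0//; nra.
Qed.

Lemma psi_arg_gt0 t : 0 < t -> 0 < psi_arg t.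
Proof.
by move=> t0; rewrite divr_gt0 ?subr_gt0 ?expRN_lt1 ?addr_gt0 ?expR_gt0.
Qed.

Lemma psi_arg_lt1 t : psi_arg t < 1.
Proof.
have x0 := expR_gt0 (- t).
by rewrite ltr_pdivrMr ?addr_gt0// mul1r; lra.
Qed.

Lemma is_derive_psi_arg t : 0 <= t ->
  is_derive t 1 psi_arg ((1 - psi_arg t ^+ true.+1) / true.+1%:R).
Proof.
move=> _; have C : is_derive t 1 (fun=> 1 : R) (0 : R) by exact: is_derive_cst.
have x0 := expR_gt0 (- t).
have n0 : 1 + expR (- t) != 0 by rewrite gt_eqF ?addr_gt0.
have Hn := is_deriveB C (is_derive_expRN t).
have Hd := @is_deriveV R ((fun=> 1) + (fun t => expR (- t))) t _ 1 n0
  (is_deriveD C (is_derive_expRN t)).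
apply: is_derive_eq (is_deriveM Hn Hd) _.
rewrite /psi_arg /GRing.scale/= !fctE.
by field.
Qed.

Lemma kernel_psi t : 0 < t -> kernel true psi_arg t = (sinh t)^-1.
Proof.
move=> t0; have e1 : 1 < expR t by rewrite expR_gt1.
rewrite /kernel /psi_arg /sinh expRN -[true.+1]/2%N.
move: (expR t) e1 => x x1.
by field; apply/and4P; split; rewrite gt_eqF//; nra.
Qed.

Lemma kernel_psi_le t : 0 < t ->
  t * kernel true psi_arg t <= 2 * (1 + t) * expR (- t).
Proof.
move=> t0; have x1 := expRN_lt1 t0; have x0 := expR_gt0 (- t).
have tx := mul_expRN_le1 t.
rewrite /kernel /psi_arg -[true.+1]/2%N.
move: (expR (- t)) x1 x0 tx => x x1 x0 tx.
have -> : t * ((1 - ((1 - x) / (1 + x)) ^+ 2) / 2 / ((1 - x) / (1 + x))) =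
  2 * x * t / ((1 - x) * (1 + x)).
  by field; rewrite !gt_eqF ?subr_gt0 ?addr_gt0.
rewrite ler_pdivrMr ?mulr_gt0 ?subr_gt0 ?addr_gt0//.
(* As for [xi], t <= (1 + t)(1 - x), and the factor 1 + x exceeds 1. *)
have : t <= (1 + t) * ((1 - x) * (1 + x)) by nra.
nra.
Qed.

Lemma tanh_half t : tanh (t / 2) = psi_arg t.
Proof.
rewrite /tanh /sinh /cosh /psi_arg.
have -> : expR (- t) = expR (- (t / 2)) ^+ 2.
  by rewrite -expRM_natl; congr expR; field.
rewrite expRN; have := expR_gt0 (t / 2); move: (expR (t / 2)) => x x0.
by field; rewrite !gt_eqF//; nra.
Qed.

Lemma xi_moment ks q : all (leq 1) ks ->
  xi ks q.+1%:R = moment false xi_arg (rev ks) q.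
Proof.
move=> k1; rewrite /xi /moment Gamma_nat; congr (_ * _).
apply: eq_Rintegral => t; rewrite inE/= in_itv/= andbT => t0.
rewrite -natr1 addrK powR_mulrn ?ltW// polylogE//; last first.
  by rewrite ger0_norm ?xi_arg_lt1// ltW// xi_arg_gt0.
by rewrite /moment_fun kernel_xi// mulrA.
Qed.

Lemma psi_moment ks q : all (leq 1) ks ->
  psi ks q.+1%:R = moment true psi_arg (rev ks) q.
Proof.
move=> k1; rewrite /psi /moment Gamma_nat; congr (_ * _).
apply: eq_Rintegral => t; rewrite inE/= in_itv/= andbT => t0.
rewrite -natr1 addrK powR_mulrn ?ltW// tanh_half ApolylogE//; last first.
  by rewrite ger0_norm ?psi_arg_lt1// ltW// psi_arg_gt0.
by rewrite /moment_fun kernel_psi// [_ / sinh t]mulrC.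
Qed.

End Instances.

Unset Implicit Arguments.
Set Strict Implicit.

Theorem theorem2p17 (R : realType) (k p r : nat)
  (hk : (0 < k)%N) (hp : (0 < p)%N) (hr : (0 < r)%N) :
  [/\ xi (rcons (nseq (r - 1) 1%N) k) (p%:R : R) =
        \sum_(1 <= j < r.+1)
          sum_compositions j (k + j - 1) (fun ks =>
            (-1) ^+ (j - 1) * ('C(p + r - j - 1, p - 1))%:R
            * xi ks ((p + r - j)%:R : R)),
      sum_compositions r (k + r - 1) (fun ks => xi ks (p%:R : R)) =
        \sum_(1 <= j < r.+1)
          (-1) ^+ (j - 1) * ('C(p + r - j - 1, p - 1))%:R
          * xi (rcons (nseq (j - 1) 1%N) k) ((p + r - j)%:R : R),
      psi (rcons (nseq (r - 1) 1%N) k) (p%:R : R) =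
        \sum_(1 <= j < r.+1)
          sum_compositions j (k + j - 1) (fun ks =>
            (-1) ^+ (j - 1) * ('C(p + r - j - 1, p - 1))%:R
            * psi ks ((p + r - j)%:R : R))
    & sum_compositions r (k + r - 1) (fun ks => psi ks (p%:R : R)) =
        \sum_(1 <= j < r.+1)
          (-1) ^+ (j - 1) * ('C(p + r - j - 1, p - 1))%:R
          * psi (rcons (nseq (j - 1) 1%N) k) ((p + r - j)%:R : R)].
Proof.
have x0 : xi_arg (0 : R) = 0 by rewrite /xi_arg oppr0 expR0 subrr.
have p0 : psi_arg (0 : R) = 0 by rewrite /psi_arg oppr0 expR0 subrr mul0r.
have [X1 X2] := duality_moment x0 (@xi_arg_gt0 R) (@xi_arg_lt1 R)
  (@is_derive_xi_arg R) (@kernel_xi_le R)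
  (fun ks q k1 _ => xi_moment q k1) hk hp hr.
have [P1 P2] := duality_moment p0 (@psi_arg_gt0 R) (@psi_arg_lt1 R)
  (@is_derive_psi_arg R) (@kernel_psi_le R)
  (fun ks q k1 _ => psi_moment q k1) hk hp hr.
by split.
Qed.
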